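(* Let $X$ be a normed space, let $s>0$, let $\varphi: X\to(-\infty,\infty]$ and $f:X\to(-\infty,\infty]$ be extended-real-valued functions with $\varphi(0)=0$, and let $T_\varphi^f(x):=\inf\{\varphi(y-x)+f(y)\mid y\in X\}$ for $x\in X$. Let $\bar x\in S_0:=\{x\in \mathrm{dom}\,T_\varphi^f\mid T_\varphi^f(x)=f(x)\}$. The following hold: (i) $\partial_sT_\varphi^f(\bar x)\subset\partial_sf(\bar x)\cap[-\partial_s\varphi(0)]$. (ii) Suppose that $\varphi$ is coercive on $X$ with constant $m>0$, and that $f$ satisfies a center-Lipschitz condition on $D:=\mathrm{dom}\,f$ at $\bar x$ with constant $\ell$, where $0\le\ell<m$. Then $$\partial_sT_\varphi^f(\bar x)=\partial_sf(\bar x)\cap[-\partial_s\varphi(0)].$$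
   Context: $X$ is a (real) normed space, $X^*$ its topological dual, and $\langle\cdot,\cdot\rangle$ the pairing between them. For $g:X\to[-\infty,\infty]$, $\mathrm{dom}\,g:=\{x\in X\mid |g(x)|<\infty\}$. For $\bar x\in\mathrm{dom}\,g$ and $s>0$, the $s$-Hölder subdifferential is $$\partial_s g(\bar x):=\Big\{x^*\in X^*\;\Big|\;\liminf_{x\to\bar x}\frac{g(x)-g(\bar x)-\langle x^*,x-\bar x\rangle}{\|x-\bar x\|^{1+s}}>-\infty\Big\},$$ where the liminf is over $x\neq\bar x$; equivalently, $x^*\in\partial_sg(\bar x)$ iff there exist $\sigma>0$, $\delta>0$ with $\langle x^*,x-\bar x\rangle\le g(x)-g(\bar x)+\sigma\|x-\bar x\|^{1+s}$ whenever $\|x-\bar x\|<\delta$. For a set $A\subset X^*$, $-A:=\{-a\mid a\in A\}$. A function $g:X\to(-\infty,\infty]$ is coercive with constant $m>0$ on $X$ if $m\|x\|\le g(x)$ for all $x\in X$. A function $g$ satisfies a center-Lipschitz condition on a set $D\subset X$ at $\bar x\in D$ with constant $\ell\ge0$ if $|g(x)-g(\bar x)|\le\ell\|x-\bar x\|$ for all $x\in D$. *)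

(* Defs.v *)
From HB Require Import structures.
From mathcomp Require Import all_boot all_order all_algebra.
From mathcomp Require Import all_classical all_reals all_analysis.
Set Implicit Arguments.
Unset Strict Implicit.
Unset Printing Implicit Defensive.
Import Order.TTheory GRing.Theory Num.Theory.
Import numFieldNormedType.Exports.
Local Open Scope classical_set_scope.
Local Open Scope ring_scope.
Local Open Scope ereal_scope.

Definition edom (R : realType) (T : Type) (g : T -> \bar R) : set T :=
  [set x | `|g x| < +oo].

Definition topological_dual (R : realType) (X : normedModType R) :
    set (X -> R) :=
  [set l : X -> R | scalar l /\ continuous l].

(* The liminf is along the punctured neighborhoods xbar^', so the value of the
   quotient at xbar is irrelevant. The numerator contains no indeterminate
   form when xbar \in edom g, the only case in which the notion is
   meaningful. *)
Definition holder_subdiff (R : realType) (X : normedModType R) (s : R)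
    (g : X -> \bar R) (xbar : X) : set (X -> R) :=
  [set l : X -> R | topological_dual l /\
    -oo < limf_einf (fun x : X =>
            (g x - g xbar - (l (x - xbar)%R)%:E)
            * ((`|(x - xbar)%R|%R `^ (1 + s))^-1)%R%:E)
          xbar^'].

Definition coercive_with (R : realType) (X : normedModType R)
    (g : X -> \bar R) (m : R) : Prop :=
  (0 < m)%R /\ forall x : X, (m * `|x|)%R%:E <= g x.

Definition center_lipschitz (R : realType) (X : normedModType R)
    (g : X -> \bar R) (D : set X) (xbar : X) (ell : R) : Prop :=
  [/\ D xbar, (0 <= ell)%R &
    forall x, D x -> `|g x - g xbar| <= (ell * `|x - xbar|)%R%:E].

Definition inf_conv (R : realType) (X : normedModType R)
    (phi f : X -> \bar R) (x : X) : \bar R :=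
  ereal_inf (range (fun y : X => phi (y - x)%R + f y)).

Definition S0 (R : realType) (X : normedModType R) (phi f : X -> \bar R) :
    set X :=
  [set x | edom (inf_conv phi f) x /\ inf_conv phi f x = f x].

(* Main.v *)
(* The infimal convolution T lies below f, touching it at xbar, and
   T (xbar - z) <= phi z + f xbar; this gives the inclusion (i). Conversely,
   adding the two subgradient inequalities at phi (y - x) and f y bounds
   phi (y - x) + f y below by f xbar + l (x - xbar), up to an error of order
   |x - xbar|^(1+s) as long as |y - x| <= C |x - xbar|; for all other y the
   strict gap ell < m makes the bound hold without error. *)
From HB Require Import structures.
Require Import Defs.
From mathcomp Require Import all_boot all_order all_algebra.
From mathcomp Require Import all_classical all_reals all_analysis.
From mathcomp Require Import lra.
Set Implicit Arguments.
Unset Strict Implicit.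
Import Order.TTheory GRing.Theory Num.Theory.
Import numFieldNormedType.Exports.
Local Open Scope classical_set_scope.
Local Open Scope ring_scope.

Section topological_dual.
Variables (R : realType) (X : normedModType R) (l : X -> R).
Hypothesis l_dual : topological_dual l.

Let L : {scalar X} := HB.pack l (GRing.isLinear.Build R X R *%R l l_dual.1).

Lemma topological_dual0 : l 0 = 0.
Proof. exact: (linear0 L). Qed.

Lemma topological_dualB x y : l (x - y) = l x - l y.
Proof. exact: (linearB L). Qed.

Lemma topological_dualN x : l (- x) = - l x.
Proof. exact: (linearN L). Qed.

Lemma topological_dual_bounded : exists2 K, 0 < K & forall x, l x <= K * `|x|.
Proof.
have /(linear_bounded_continuous (L : {linear X -> R^o})).2 := l_dual.2.
move/(linear_boundedP (L : {linear X -> R^o})).1/pinfty_ex_gt0 => [K K0 lK].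
by exists K => // x; exact: le_trans (ler_norm _) (lK x).
Qed.

Lemma topological_dual_opp : topological_dual (- l).
Proof.
split; first by move=> a x y; rewrite !fctE l_dual.1 opprD mulrN.
by move=> x; apply: (@cvgN R R^o); exact: l_dual.2.
Qed.

End topological_dual.

(** Trades the liminf for a local inequality in the increment [h]: the liminf is a supremum of
    infima over punctured neighborhoods, so it exceeds [-oo] exactly when the quotient has a real
    lower bound on one of them. Multiplying by the positive power of the norm clears the
    quotient. *)
Lemma holder_subdiffP (R : realType) (X : normedModType R) (s : R)
    (g : X -> \bar R) (xbar : X) (c : R) (l : X -> R) :
  0 < s -> g xbar = c%:E ->
  holder_subdiff s g xbar l <->
  topological_dual l /\ exists sigma delta : R, [/\ 0 <= sigma, 0 < delta &
    forall h : X, `|h| < delta ->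
      ((c + l h - sigma * `|h| `^ (1 + s))%:E <= g (xbar + h)%R)%E].
Proof.
move=> s0 gc; split=> -[l_dual H]; split=> //.
  move: H; rewrite limf_einfE => /ereal_sup_gt[_ [V nV <-]] infV.
  (* The infimum itself may be [+oo], for instance when [g] is infinite on all of [V]; any real
     lower bound will do. *)
  have [r rV] : exists r : R, (r%:E <= ereal_inf
     ((fun x => (g x - g xbar - (l (x - xbar))%:E)
       * ((`|x - xbar| `^ (1 + s))^-1)%:E) @` V))%E.
    case: (ereal_inf _) infV => [r _|_|//]; first by exists r.
    by exists 0; rewrite leey.
  have /nbhs_normP[d /= d0 dV] := nV.
  exists (Num.max 0 (- r)), d; split => //; first by rewrite le_max lexx.
  (* The punctured neighborhood says nothing at [h = 0], where both sides equal [c]. *)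
  move=> h hd; have [->|h0] := eqVneq h 0.
    rewrite (topological_dual0 l_dual) normr0 powR0 ?gt_eqF ?addr_gt0//.
    by rewrite mulr0 subr0 !addr0 gc.
  have p0 : 0 < `|h| `^ (1 + s) by rewrite powR_gt0 ?normr_gt0.
  have : V (xbar + h).
    apply: dV; first by rewrite /= opprD addNKr normrN.
    by rewrite /= addrC -subr_eq0 addrK.
  move/(imageP (fun x => (g x - g xbar - (l (x - xbar))%:E)
       * ((`|x - xbar| `^ (1 + s))^-1)%:E)%E)/ereal_inf_lbound/(le_trans rV).
  have hE : xbar + h - xbar = h by rewrite addrAC subrr add0r.
  rewrite /= hE gc.
  (* The value [-oo] would make the quotient [-oo], below the real bound [r]. *)
  case: (g (xbar + h)) => [b| |] //=; last first.
  - by rewrite mulNyr gtr0_sg ?invr_gt0// mul1e leeNy_eq.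
  - by rewrite leey.
  rewrite -!EFinB -EFinM !lee_fin ler_pdivlMr// => rb.
  have : - (Num.max 0 (- r)) * `|h| `^ (1 + s) <= r * `|h| `^ (1 + s).
    by rewrite ler_pM2r// lerNl le_max lexx orbT.
  lra.
case: H => sigma [d [sigma0 d0 H]].
rewrite limf_einfE; apply: (@lt_le_trans _ _ (- sigma)%:E); first exact: ltNyr.
apply: ereal_sup_ge; exists (ereal_inf ((fun x => (g x - g xbar - (l (x - xbar))%:E)
       * ((`|x - xbar| `^ (1 + s))^-1)%:E)%E @` (ball xbar d `\ xbar))).
  exists (ball xbar d `\ xbar) => //.
  apply/nbhs_ballP; exists d => // y dy /= yx; split => //.
  exact/eqP.
apply/ereal_infP => _ [y [dy /eqP yx] <-].
have h0 : 0 < `|y - xbar| by rewrite normr_gt0 subr_eq0.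
have p0 : 0 < `|y - xbar| `^ (1 + s) by rewrite powR_gt0.
have := H (y - xbar); rewrite (addrC xbar) subrK gc.
rewrite -ball_normE /= distrC in dy; move=> /(_ dy).
case: (g y) => [b| |] //; last first.
- by move=> _; rewrite !addye// mulyr gtr0_sg ?invr_gt0// mul1e leey.
rewrite -!EFinB -EFinM !lee_fin ler_pdivlMr//; lra.
Qed.

Theorem theorem3p1 (R : realType) (X : normedModType R) (s : R)
    (phi f : X -> \bar R) (xbar : X) :
  0 < s ->
  (forall x, -oo < phi x)%E -> (forall x, -oo < f x)%E ->
  phi 0 = 0%E ->
  S0 phi f xbar ->
  (holder_subdiff s (inf_conv phi f) xbar `<=`
     holder_subdiff s f xbar `&` [set - l | l in holder_subdiff s phi 0])
  /\
  (forall m ell : R,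
     coercive_with phi m ->
     center_lipschitz f (edom f) xbar ell ->
     0 <= ell < m ->
     holder_subdiff s (inf_conv phi f) xbar =
       holder_subdiff s f xbar `&` [set - l | l in holder_subdiff s phi 0]).
Proof.
move=> s0 phiNy fNy phi0 [Tdom Tf].
have [c Tc fc] : exists2 c, inf_conv phi f xbar = c%:E & f xbar = c%:E.
  move: Tdom Tf; rewrite /edom /=.
  by case: (inf_conv _ _ _) => [c| |] //= _ <-; exists c.
have T_le x y : (inf_conv phi f x <= phi (y - x)%R + f y)%E.
  by apply: ereal_inf_lbound; exists y.
have part1 : holder_subdiff s (inf_conv phi f) xbar `<=`
    holder_subdiff s f xbar `&` [set - l | l in holder_subdiff s phi 0].
  move=> l /(holder_subdiffP _ s0 Tc)[l_dual [sg [d [sg0 d0 H]]]].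
  split.
    apply/(holder_subdiffP _ s0 fc); split=> //.
    exists sg, d; split=> // h /H /le_trans; apply.
    by have := T_le (xbar + h) (xbar + h); rewrite subrr phi0 add0e.
  exists (- l); last by rewrite opprK.
  apply/(holder_subdiffP _ s0 phi0); split.
    exact: topological_dual_opp.
  exists sg, d; split=> // h hd.
  (* At the point [xbar - h], the competitor [y = xbar] gives [y - x = h]. *)
  have := H (- h); rewrite normrN => /(_ hd)/le_trans/(_ (T_le _ xbar)).
  rewrite opprB addrCA subrr addr0 !add0r fc (topological_dualN l_dual) fctE.
  case: (phi h) => [b| |] //=; last by move=> _; rewrite leey.
  by rewrite -EFinD !lee_fin; lra.
split=> // m ell [m0 phi_coer] [_ _ f_lip] /andP[ell0 ellm].
apply/seteqP; split=> // l [/(holder_subdiffP _ s0 fc)].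
move=> [l_dual [sf [df [sf0 df0 Hf]]]] [k].
move/(holder_subdiffP _ s0 phi0) => [_ [sp [dp [sp0 dp0 Hp]]]] kl.
have {k kl}Hp h : `|h| < dp ->
    ((- l h - sp * `|h| `^ (1 + s))%:E <= phi h)%E.
  by move=> /Hp; rewrite -kl !fctE opprK !add0r.
have [K K0 lK] := topological_dual_bounded l_dual.
(* Beyond distance C * |h| from xbar + h, coercivity of phi beats the Lipschitz
   growth of f and the linear term l h. *)
pose C := (ell + K) / (m - ell).
have mell : 0 < m - ell by rewrite subr_gt0.
have C0 : 0 <= C by apply: divr_ge0; [rewrite addr_ge0//|]; exact: ltW.
have mC : (m - ell) * C = ell + K by rewrite mulrC divfK// gt_eqF.
have C1 : 0 < C + 1 by rewrite ltr_wpDl.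
have C1_ge0 := ltW C1.
apply/(holder_subdiffP _ s0 Tc); split=> //.
(* In the near case the increments of [phi] and [f] have norms at most [C * |h|] and
   [(C + 1) * |h|]. The radius keeps both in the range of the local inequalities, and the constant
   adds the two errors. *)
exists (sp * C `^ (1 + s) + sf * (C + 1) `^ (1 + s)), (Num.min dp df / (C + 1)).
split; first by rewrite addr_ge0 ?mulr_ge0 ?powR_ge0.
  by rewrite divr_gt0// lt_min dp0.
move=> h; rewrite ltr_pdivlMr// lt_min => /andP[hp hf].
apply/ereal_infP => _ [y _ <-].
have [fy|fy] := pselect (f y = +oo%E).
  by rewrite fy addey ?leey// gt_eqF.
have {fy}[b fb] : exists b, f y = b%:E.
  by move: fy (fNy y); case: (f y) => // b _ _; exists b.
have [py|py] := pselect (phi (y - (xbar + h)) = +oo%E).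
  by rewrite py addye ?leey// fb.
have {py}[a pa] : exists a, phi (y - (xbar + h)) = a%:E.
  by move: py (phiNy (y - (xbar + h))); case: (phi _) => // a _ _; exists a.
pose k := y - xbar.
have kh : y - (xbar + h) = k - h by rewrite opprD addrA.
have ky : xbar + k = y by rewrite addrC subrK.
have w0 := normr_ge0 h.
have v_le : `|k| <= `|k - h| + `|h| by rewrite -{1}(subrK h k) ler_normD.
rewrite pa fb -EFinD lee_fin.
have [uC|uC] := leP (`|k - h|) (C * `|h|).
  (* Near case: when the two subgradient inequalities are added, the linear terms [- l (k - h)] and
     [l k] leave [l h]. *)
  have vC : `|k| <= (C + 1) * `|h| by lra.
  have := Hp (k - h); rewrite -kh pa lee_fin kh.
  have /[swap]/[apply] : `|k - h| < dp by lra.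
  have := Hf k; rewrite ky fb lee_fin.
  have /[swap]/[apply] : `|k| < df by lra.
  rewrite (topological_dualB l_dual k h).
  have s1 : 0 <= 1 + s by lra.
  have : sp * `|k - h| `^ (1 + s) <= sp * (C `^ (1 + s) * `|h| `^ (1 + s)).
    by rewrite ler_wpM2l// -powRM// ge0_ler_powR// nnegrE// mulr_ge0.
  have : sf * `|k| `^ (1 + s) <= sf * ((C + 1) `^ (1 + s) * `|h| `^ (1 + s)).
    by rewrite ler_wpM2l// -powRM// ge0_ler_powR// nnegrE// mulr_ge0.
  lra.
(* Far case: with [u = |k - h|], [a + b >= m * u + c - ell * (u + |h|)], and
   [(m - ell) * u >= (ell + K) * |h|] leaves at least [c + K * |h| >= c + l h]. *)
have := phi_coer (k - h); rewrite -kh pa lee_fin kh => am.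
have /f_lip : edom f y by rewrite /edom /= fb /= ltry.
rewrite fb fc -EFinB lee_fin ler_norml => /andP[bell _].
have lh := lK h.
have : (m - ell) * (C * `|h|) <= (m - ell) * `|k - h| by rewrite ler_pM2l// ltW.
rewrite mulrA mC.
have : ell * `|k| <= ell * (`|k - h| + `|h|) by rewrite ler_wpM2l.
have : 0 <= (sp * C `^ (1 + s) + sf * (C + 1) `^ (1 + s)) * `|h| `^ (1 + s).
  by rewrite mulr_ge0 ?addr_ge0 ?mulr_ge0 ?powR_ge0.
rewrite -/k in bell; lra.
Qed.
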